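(* Let $\mu,\nu,\lambda$ be partitions and let $n=\max\{\ell(\mu),\ell(\nu),\ell(\lambda)\}$. Then the degree of the quasi-polynomial $n_{t\mu,t\nu}^{t\lambda}$ in $t$ satisfies $$\deg n_{t\mu,t\nu}^{t\lambda}\leq \frac{3n(n-1)}{2}.$$ That is, if $P_e,P_o$ are polynomials such that for all integers $t\geq1$ one has $n_{t\mu,t\nu}^{t\lambda}=P_e(t)$ for $t$ even and $n_{t\mu,t\nu}^{t\lambda}=P_o(t)$ for $t$ odd, then $P_e$ and $P_o$ both have degree at most $3n(n-1)/2$.
   Context: For partitions $\mu,\nu,\lambda$, let $c_{\mu,\nu}^{\lambda}$ be the Littlewood--Richardson coefficient, i.e. the coefficient of the Schur function $s_\lambda$ in $s_\mu s_\nu$. The Newell--Littlewood coefficient is $$n_{\mu,\nu}^{\lambda}=\sum_{\alpha,\beta,\gamma} c_{\alpha,\beta}^{\mu}\,c_{\alpha,\gamma}^{\nu}\,c_{\beta,\gamma}^{\lambda},$$ the sum being over all partitions $\alpha,\beta,\gamma$. $\ell(\kappa)$ is the number of nonzero parts of a partition $\kappa$ and $t\kappa=(t\kappa_1,t\kappa_2,\ldots)$. It is known that, as a function of $t$, $n_{t\mu,t\nu}^{t\lambda}$ is a quasi-polynomial of quasi-period at most $2$, i.e. polynomials $P_e,P_o$ as in the claim exist; its degree is the maximum of the degrees of $P_e$ and $P_o$. The zero polynomial is regarded as having degree $-\infty$. *)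

(* Defs.v *)
From HB Require Import structures.
From mathcomp Require Import all_boot all_order all_algebra fraction finmap.
From mathcomp Require Import boolp classical_sets cardinality fsbigop.
From mathcomp Require Import mpoly.

Set Implicit Arguments.
Unset Strict Implicit.
Unset Printing Implicit Defensive.

Import GRing.Theory.

Local Open Scope ring_scope.

(* An integer partition is the weakly decreasing sequence of its nonzero      *)
(* parts, so equality is equality of partitions and the length l(kappa) is    *)
(* size kappa.                                                                *)
Definition is_intpart (s : seq nat) : bool := sorted geq s && (0%N \notin s).

Record intpart := IntPart { parts :> seq nat; _ : is_intpart parts }.

HB.instance Definition _ := [isSub for parts].
HB.instance Definition _ := [Choice of intpart by <:].

Definition empty_part : intpart := @IntPart [::] isT.

(* The filter only matters for t = 0, where all parts vanish.                 *)
Definition scale_parts (t : nat) (s : seq nat) : seq nat :=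
  [seq y <- [seq (t * x)%N | x <- s] | (0 < y)%N].

Lemma scale_parts_subproof (t : nat) (kappa : intpart) :
  is_intpart (scale_parts t kappa).
Proof.
case: kappa => s /= /andP[s_sorted _].
rewrite /is_intpart /scale_parts mem_filter ltnn andbT.
apply: sorted_filter => [y x z yx zy|]; first exact: leq_trans zy yx.
rewrite sorted_map; apply: sub_sorted s_sorted => x y /= yx.
by rewrite leq_mul2l; apply/orP; right.
Qed.

Definition scale_part (t : nat) (kappa : intpart) : intpart :=
  IntPart (scale_parts_subproof t kappa).

(* det (x_i ^ (kappa_j + N - j)), 1 <= i, j <= N; with indices starting at 0  *)
(* the exponent is kappa_j + (N - 1 - j).                                     *)
Definition alternant (N : nat) (kappa : intpart) : {mpoly int[N]} :=
  \det (\matrix_(i < N, j < N) ('X_i ^+ (nth 0%N kappa j + (N.-1 - j)))).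

(* The image of the Schur function s_kappa in N variables: the quotient of    *)
(* alternants (the denominator is the Vandermonde determinant), and 0 when    *)
(* kappa has more than N parts.  A symmetric function is the family of its    *)
(* images in all finite numbers N of variables.                               *)
Definition schur (N : nat) (kappa : intpart) : {fraction {mpoly int[N]}} :=
  if (size kappa <= N)%N
  then tofrac (alternant N kappa) / tofrac (alternant N empty_part)
  else 0.

(* f is the family of coefficients of the expansion of s_mu * s_nu in the     *)
(* basis of Schur functions.                                                  *)
Definition is_schur_expansion (mu nu : intpart)
    (f : {fsfun intpart -> int with 0}) : Prop :=
  forall N : nat,
    schur N mu * schur N nu = \sum_(la <- finsupp f) schur N la *~ f la.

(* The product has exactly one such expansion, so the default value of xget   *)
(* plays no role.                                                             *)
Definition lr_coef (mu nu la : intpart) : int :=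
  xget [fsfun] [set f | is_schur_expansion mu nu f]%classic la.

(* The sum is finitely supported: a nonzero term forces the diagrams of alpha *)
(* and beta to be contained in that of mu, and that of gamma in nu.           *)
Definition nl_coef (mu nu la : intpart) : int :=
  \sum_(p \in [set: intpart * intpart * intpart]%classic)
    (let: (alpha, beta, gamma) := p in
     lr_coef alpha beta mu * lr_coef alpha gamma nu * lr_coef beta gamma la).

(* Main.v *)
Require Import Defs.
From mathcomp Require Import all_boot all_order all_algebra.
From mathcomp Require Import fraction finmap perm boolp classical_sets fsbigop.
From mathcomp Require Import mpoly zify.

(* Put N = max(n, 1) and let delta = (N - 1, ..., 1, 0).  In N variables,     *)
(* c_{mu,nu}^la is the coefficient of x^(la + delta) in                       *)
(* F = a_{mu + delta} a_{nu + delta} / a_delta, the numerator being a sum of  *)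
(* (N!)^2 signed monomials.  Dividing by the factors x_j - x_0 (j > 0) of the *)
(* Vandermonde determinant a_delta turns a monomial into a series with        *)
(* coefficients 0 and 1, up to sign; each of the remaining (N - 1)(N - 2) / 2 *)
(* factors multiplies the bound on the coefficients by the degree.  Hence     *)
(* c_{mu,nu}^la = O(|la|^((N - 1)(N - 2) / 2)), independently of mu and nu.   *)
(* In the sum defining n_{mu,nu}^la the sizes of alpha, beta and gamma are    *)
(* determined by those of mu, nu and la, and these partitions have at most N  *)
(* parts, which leaves O(t^(3(N - 1))) terms after scaling by t.  The total   *)
(* exponent is 3(N - 1) + 3(N - 1)(N - 2) / 2 = 3N(N - 1) / 2.                *)

Set Implicit Arguments.
Unset Strict Implicit.
Unset Printing Implicit Defensive.

Import Order.TTheory GRing.Theory Num.Theory.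
Local Open Scope ring_scope.

(** The degree is read off from growth: an $O(t^d)$ bound along all even, respectively all odd, $t$
    forces degree at most $d$ ([size_poly_growth]). The growth bound [nl_coef_bound] multiplies the
    number of contributing triples ([intparts_cover]) by three Littlewood--Richardson bounds
    ([lr_coef_bound]). The exponent comes out right because the $N-1$ Vandermonde factors forming a
    star cost nothing ([ldivs_star_le]); charging a degree factor for every division ([ldivs_le])
    would give $3N(N-1)/2+3(N-1)$. *)

(** * Division by linear factors on coefficient functions *)

Section LinearDivision.
Variable n : nat.
Implicit Types (c : 'X_{1..n} -> int) (e m : 'X_{1..n}) (d : 'I_n * 'I_n).
Implicit Types (F : {mpoly int[n]}) (L : seq ('I_n * 'I_n)).

Definition lfactor d : {mpoly int[n]} := 'X_d.1 - 'X_d.2.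

(* Coefficient form of dividing by x_i - x_j for d = (i, j), by means of      *)
(* 1 / (x_i - x_j) = \sum_k x_j^k / x_i^(k+1); the truncated subtraction is   *)
(* exact since k <= e_j.                                                      *)
Definition ldiv d c e : int :=
  \sum_(k < (e d.2).+1) c (e + U_(d.1) *+ k.+1 - U_(d.2) *+ k)%MM.

Definition ldivs L c := foldl (fun c d => ldiv d c) c L.

Lemma mcoeff_mulXU F i e :
  (F * 'X_i)@_e = if (0 < e i)%N then F@_(e - U_(i))%MM else 0.
Proof.
case: ifP => ei.
  have {1}-> : e = (U_(i) + (e - U_(i)))%MM.
    by apply/mnmP => j; rewrite mnmDE mnmBE mnm1E; case: eqVneq => [<-|] /=; lia.
  by rewrite mcoeffMX.
apply/eqP; rewrite mcoeff_eq0 (perm_mem (msuppMX _ _)).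
apply/negP => /mapP[m _ eE]; move: ei.
by rewrite eE mnmDE mnm1E eqxx.
Qed.

Lemma mcoeff_ldiv d F e : d.1 != d.2 ->
  F@_e = ldiv d (fun m => (lfactor d * F)@_m) e.
Proof.
case: d => i j /= ij; rewrite /ldiv /lfactor /=.
(* The $k$-th term of [ldiv] is [G k - G k.+1], so the sum telescopes to [G 0], the coefficient at
   [e]; [G] is 0 once the exponent of $x_j$ would become negative. *)
pose G k := if (k <= e j)%N then F@_(e + U_(i) *+ k - U_(j) *+ k)%MM else 0.
rewrite (eq_bigr (fun k : 'I_(e j).+1 => G k - G k.+1)); last first.
  case=> k /= kj _; rewrite mulrC mulrBr mcoeffB !mcoeff_mulXU.
  rewrite !mnmBE !mnmDE !mulmnE !mnm1E !eqxx (negbTE ij) eq_sym (negbTE ij).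
  rewrite !mul0n !mul1n addn0 subn0 addnS ltn0Sn subn_gt0 /G -(ltnS k) kj.
  congr (F@__ - _); last (case: ifP => // kj'; congr (F@__));
    apply/mnmP => l; rewrite ?(mnmBE, mnmDE, mulmnE, mnm1E);
    case: (eqVneq i l) => [il|_]; case: (eqVneq j l) => [jl|_] /=; subst; lia.
rewrite -(big_mkord xpredT (fun k => G k - G k.+1)).
have -> : \sum_(0 <= k < (e j).+1) (G k - G k.+1)
    = - \sum_(0 <= k < (e j).+1) (G k.+1 - G k).
  by rewrite -sumrN; apply: eq_bigr => k _; rewrite opprB.
rewrite telescope_sumr // /G ltnn leq0n add0r opprK.
by congr (F@__); apply/mnmP => l; rewrite mnmBE mnmDE !mulmnE !muln0; lia.
Qed.

Lemma eq_ldiv d c1 c2 : c1 =1 c2 -> ldiv d c1 =1 ldiv d c2.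
Proof. by move=> cE e; apply: eq_bigr => k _; apply: cE. Qed.

Lemma eq_ldivs L c1 c2 : c1 =1 c2 -> ldivs L c1 =1 ldivs L c2.
Proof. by elim: L c1 c2 => //= d L IH c1 c2 cE; apply/IH/eq_ldiv. Qed.

Lemma mcoeff_ldivs L F : all (fun d => d.1 != d.2) L ->
  forall e, F@_e = ldivs L (fun m => ((\prod_(d <- L) lfactor d) * F)@_m) e.
Proof.
elim: L F => [|d L IH] F /=; first by move=> _ e; rewrite big_nil mul1r.
case/andP=> dd Ld e; rewrite [LHS]IH //; apply: eq_ldivs => m.
by rewrite (@mcoeff_ldiv d) //; apply: eq_ldiv => m'; rewrite big_cons mulrA.
Qed.

(** A single monomial need not be divisible by the factors, but [ldivs] acts on arbitrary functions;
    linearity then lets a numerator be divided monomial by monomial. *)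
Lemma ldivs_sum (I : finType) (a : I -> int) (c : I -> 'X_{1..n} -> int) L e :
  ldivs L (fun m => \sum_i a i * c i m) e = \sum_i a i * ldivs L (c i) e.
Proof.
elim: L c e => //= d L IH c e; rewrite -IH; apply: eq_ldivs => m.
rewrite /ldiv exchange_big; apply: eq_bigr => i _ /=.
by rewrite mulr_sumr.
Qed.

Lemma ldiv_neq0 d c e : ldiv d c e != 0 ->
  exists k, [/\ (k <= e d.2)%N & c (e + U_(d.1) *+ k.+1 - U_(d.2) *+ k)%MM != 0].
Proof.
move=> nz; apply/not_existsP => H; case/eqP: nz; apply: big1 => -[k kP] _ /=.
by apply/eqP/negPn/negP => nz; apply: (H k).
Qed.

Lemma mdeg_ldiv_arg i j e k : (k <= e j)%N ->
  mdeg (e + U_(i) *+ k.+1 - U_(j) *+ k)%MM = (mdeg e).+1.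
Proof.
move=> kj; apply/eqP; rewrite -(eqn_add2r (mdeg (U_(j) *+ k)%MM)) -mdegD submK.
  by rewrite mdegD !mdegMn !mdeg1; lia.
apply/mnm_lepP => l; rewrite !(mulmnE, mnmDE, mnm1E).
by case: eqVneq => [<-|] /=; lia.
Qed.

(** Each division lowers the degree by exactly one. This homogeneity later fixes the sizes of the
    partitions. *)
Lemma ldivs_neq0 L c e : ldivs L c e != 0 ->
  exists2 m, mdeg m = (mdeg e + size L)%N & c m != 0.
Proof.
elim: L c e => [|d L IH] c e /=; first by exists e; rewrite ?addn0.
move=> /IH[m mE] /ldiv_neq0[k [kd nz]].
by exists (m + U_(d.1) *+ k.+1 - U_(d.2) *+ k)%MM; rewrite ?mdeg_ldiv_arg ?mE ?addnS.
Qed.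

(* One division costs a factor bounded by the degree, since the geometric     *)
(* series it unfolds has at most [mdeg e + 1] terms.                          *)
Lemma ldivs_le L c (B r : nat) :
  (forall e, `|c e| <= (B * (mdeg e + r) ^ r)%:Z) ->
  forall e, `|ldivs L c e| <= (B * (mdeg e + (r + size L)) ^ (r + size L))%:Z.
Proof.
elim: L c r => [|d L IH] c r cB e /=; first by rewrite addn0.
rewrite -[(r + _)%N]addSnnS; apply: IH => {}e.
rewrite /ldiv; apply: le_trans (ler_norm_sum _ _ _) _.
apply: (@le_trans _ _ (\sum_(k < (e d.2).+1) (B * (mdeg e + r.+1) ^ r)%:Z)).
  apply: ler_sum => -[k kd] _ /=; apply: le_trans (cB _) _.
  by rewrite mdeg_ldiv_arg // addSnnS.
rewrite sumr_const card_ord -mulr_natr natz -PoszM lez_nat.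
rewrite expnSr mulnA leq_mul2l; apply/orP; right.
rewrite addnS ltnS; apply: leq_trans (leq_addr _ _).
by rewrite mdegE (bigD1 d.2) //= leq_addr.
Qed.

(* Dividing along the edges of a star: each division frees one coordinate,    *)
(* and its geometric series meets the coordinate's old value at most once.    *)
Lemma ldiv_star (i0 j : 'I_n) (s : seq 'I_n) c m :
  j != i0 -> j \notin s ->
  (forall e, `|c e| <= 1) ->
  (forall e v, c e != 0 -> v != i0 -> v \notin s -> e v = m v) ->
  (forall e, `|ldiv (j, i0) c e| <= 1) /\
  (forall e v, ldiv (j, i0) c e != 0 -> v != i0 -> v \notin j :: s -> e v = m v).
Proof.
move=> ji0 js c1 cm; split=> e; last first.
  move=> v /ldiv_neq0[k [/= kd /cm cE]] vi0; rewrite inE negb_or => /andP[vj vs].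
  have := cE v vi0 vs; rewrite mnmBE mnmDE !mulmnE !mnm1E.
  by rewrite eq_sym (negbTE vj) eq_sym (negbTE vi0) !mul0n addn0 subn0.
have cj (k : 'I_(e i0).+1) : c (e + U_(j) *+ k.+1 - U_(i0) *+ k)%MM != 0 ->
    (e j + k.+1)%N = m j.
  move=> /cm/(_ ji0 js); rewrite mnmBE mnmDE !mulmnE !mnm1E eqxx.
  by rewrite eq_sym (negbTE ji0) mul0n mul1n subn0.
case: (boolP [exists k : 'I_(e i0).+1, c (e + U_(j) *+ k.+1 - U_(i0) *+ k)%MM != 0]).
  move=> /existsP[k ck]; rewrite /ldiv /= (bigD1 k) //= big1 ?addr0 // => l lk.
  apply/eqP/negPn/negP => /cj; rewrite -(cj _ ck) => /eqP.
  by rewrite eqn_add2l eqSS => /eqP/val_inj/eqP; rewrite (negbTE lk).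
rewrite negb_exists => /forallP c0; rewrite /ldiv big1 ?normr0 // => k _.
by apply/eqP; rewrite -[_ == _]negbK; apply: c0.
Qed.

Lemma ldivs_star_le (i0 : 'I_n) (s : seq 'I_n) m e :
  uniq (i0 :: s) ->
  `|ldivs [seq (j, i0) | j <- s] (fun m' => (m == m')%:R) e| <= 1.
Proof.
move=> /= /andP[i0s us].
(* Invariant of the induction: [t] lists the coordinates already freed, and monomials in the support
   of [c] agree with [m] away from [i0] and [t]. *)
suff H t c : uniq (t ++ s) -> i0 \notin s -> (forall e, `|c e| <= 1) ->
    (forall e v, c e != 0 -> v != i0 -> v \notin t -> e v = m v) ->
    `|ldivs [seq (j, i0) | j <- s] c e| <= 1.
  apply: (H [::]) => // [e'|e' v]; first by case: eqP; rewrite ?normr0.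
  by rewrite pnatr_eq0 eqb0 negbK => /eqP->.
elim: s t c e {i0s us} => //= j s IH t c e uts.
rewrite inE negb_or => /andP[i0j i0s] c1 cm.
have [ji0 jt] : j != i0 /\ j \notin t.
  split; first by rewrite eq_sym.
  by move: uts; rewrite cat_uniq /= negb_or => /and3P[_ /andP[]].
have [d1 dm] := ldiv_star ji0 jt c1 cm.
by apply: (IH (j :: t)) => //; move: uts; rewrite -cat1s uniq_catCA.
Qed.

End LinearDivision.

(** * The Vandermonde determinant, split into a star and the remaining factors *)

Definition star_edges p : seq ('I_p.+1 * 'I_p.+1) :=
  [seq (j, ord0) | j <- [seq lift ord0 i | i <- enum 'I_p]].

Definition other_edges p : seq ('I_p.+1 * 'I_p.+1) :=
  [seq (lift ord0 d.2, lift ord0 d.1)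
     | d : 'I_p * 'I_p <- enum {: 'I_p * 'I_p} & (d.1 < d.2)%N].

Lemma size_other_edges p : size (other_edges p) = 'C(p, 2).
Proof.
rewrite size_map -sum1_size big_filter big_enum_cond /=.
rewrite -(pair_big_dep xpredT (fun i j : 'I_p => (i < j)%N) (fun _ _ => 1%N)) /=.
rewrite (exchange_big_dep xpredT) //= -bin2_sum big_mkord.
apply: eq_bigr => j _; rewrite -(big_ord_widen_cond _ xpredT (fun=> 1%N)) //=.
  by rewrite sum1_card card_ord.
exact: ltnW.
Qed.

Lemma size_edges p : size (star_edges p ++ other_edges p) = 'C(p.+1, 2).
Proof.
by rewrite size_cat size_other_edges 2!size_map size_enum_ord binS bin1 addnC.
Qed.

Lemma edges_neq p :
  all (fun d : 'I_p.+1 * 'I_p.+1 => d.1 != d.2) (star_edges p ++ other_edges p).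
Proof.
apply/allP => d; rewrite mem_cat => /orP[].
  by move=> /mapP[_ /mapP[i _ ->] ->]; rewrite eq_sym; apply: neq_lift.
move=> /mapP[[i j]]; rewrite mem_filter /= => /andP[ij _] ->.
by rewrite /= (inj_eq lift_inj); apply: contraTneq ij => ->; rewrite ltnn.
Qed.

(** Reversing the columns gives a transposed Vandermonde matrix; the sign is that of the
    reversal. *)
Lemma alternant_empty p : exists b : bool,
  alternant p.+1 empty_part
    = (-1) ^+ b * \prod_(d <- star_edges p ++ other_edges p) lfactor d.
Proof.
pose s := perm (@rev_ord_inj p.+1).
pose V : 'M[{mpoly int[p.+1]}]_p.+1 := Vandermonde p.+1 (\row_i 'X_i).
exists (s^-1)%g; rewrite /alternant.
have -> : \matrix_(i < p.+1, j < p.+1)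
    ('X_i ^+ (nth 0%N empty_part j + (p.+1.-1 - j))) = col_perm s V^T
    :> 'M[{mpoly int[p.+1]}]_p.+1.
  apply/matrixP => i j; rewrite !mxE /= nth_nil add0n permE.
  by rewrite /= subSS.
rewrite col_permE det_mulmx det_perm det_tr mulrC; congr (_ * _).
rewrite det_Vandermonde big_cat big_ord_recl; congr (_ * _).
  rewrite 2!big_map big_enum /= big_mkcond big_ord_recl /= mul1r.
  by apply: eq_bigr => i _; rewrite !mxE.
rewrite big_map big_filter big_enum_cond /=.
rewrite -(pair_big_dep xpredT (fun i j : 'I_p => (i < j)%N)
  (fun i j => lfactor (lift ord0 j, lift ord0 i))) /=.
apply: eq_bigr => i _; rewrite big_mkcond big_ord_recl /= mul1r -big_mkcond.
by apply: eq_big => j //= _; rewrite !mxE.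
Qed.

(** The star is divided out first, while the input is still a single monomial: each monomial then
    contributes at most 1, hence [#|I|] in total. Only the other ['C(p, 2)] divisions cost a degree
    factor. *)
Lemma alternant_dvd_coef p (I : finType) (a : I -> int)
    (m : I -> 'X_{1..p.+1}) (F : {mpoly int[p.+1]}) (e : 'X_{1..p.+1}) :
    alternant p.+1 empty_part * F = \sum_i a i *: 'X_[m i] ->
    (forall i, `|a i| <= 1) ->
  `|F@_e| <= (#|I| * (mdeg e + 'C(p, 2)) ^ 'C(p, 2))%N%:Z /\
  (F@_e != 0 -> exists i, mdeg (m i) = (mdeg e + 'C(p.+1, 2))%N).
Proof.
have [b ->] := alternant_empty p => FE a1.
pose a' i := (-1) ^+ b * a i.
have FE' : \prod_(d <- star_edges p ++ other_edges p) lfactor d * F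
    = \sum_i a' i *: 'X_[m i].
  have -> : \sum_i a' i *: 'X_[m i] = (-1) ^+ b *: \sum_i a i *: 'X_[m i] :> {mpoly int[p.+1]}.
    by rewrite scaler_sumr; apply: eq_bigr => i _; rewrite scalerA.
  rewrite -FE -mulrA -mul_mpolyC rmorphXn rmorphN rmorph1.
  by rewrite !mulrA -expr2 sqrr_sign mul1r.
have a1' i : `|a' i| <= 1 by rewrite normrM normrX normrN1 expr1n mul1r.
have FeE : F@_e = ldivs (star_edges p ++ other_edges p)
    (fun e => \sum_i a' i * (m i == e)%:R) e.
  rewrite (mcoeff_ldivs _ (edges_neq p)); apply: eq_ldivs => e'.
  rewrite FE' linear_sum /=; apply: eq_bigr => i _.
  by rewrite mcoeffZ mcoeffX.
split; last first.
  rewrite FeE => /ldivs_neq0[e' e'E nz]; rewrite -size_edges -e'E.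
  apply/not_existsP => H; case/eqP: nz; apply: big1 => i _.
  by case: eqP => [mi|_]; rewrite ?mulr0 //; case: (H i); rewrite mi.
rewrite {}FeE /ldivs foldl_cat -/(ldivs _ _) -/(ldivs _ _) -size_other_edges.
rewrite -[X in (_ + X)%N]add0n -[X in (_ ^ X)%N]add0n.
apply: ldivs_le => {}e; rewrite expn0 muln1 ldivs_sum.
apply: le_trans (ler_norm_sum _ _ _) _.
rewrite -sum1_card -natz natr_sum; apply: ler_sum => i _.
rewrite normrM -[leRHS]mulr1; apply: ler_pM => //; apply: ldivs_star_le.
rewrite cons_uniq map_inj_uniq ?enum_uniq ?andbT; last exact: lift_inj.
by apply/mapP => -[j _ /eqP]; rewrite (negbTE (neq_lift _ _)).
Qed.

(** * Monomials of alternants *)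

Definition shifted_part N (kappa : intpart) (j : 'I_N) : nat :=
  (nth 0 kappa j + (N.-1 - j))%N.

Definition alt_mnm N (kappa : intpart) (s : 'S_N) : 'X_{1..N} :=
  [multinom shifted_part kappa (s i) | i < N].

Lemma intpart_nth_geq (kappa : intpart) i j :
  (i <= j)%N -> (nth 0 kappa j <= nth 0 kappa i)%N.
Proof.
case: kappa => s /= /andP[ss _] ij.
have [sj|js] := leqP (size s) j; first by rewrite nth_default.
have := @sorted_leq_nth _ geq _ _ 0%N s ss i j.
rewrite !inE js (leq_ltn_trans ij js); apply => //.
  by move=> y x z /= yx zy; apply: leq_trans zy yx.
exact: leqnn.
Qed.

Lemma intpart_nth_gt0 (kappa : intpart) i :
  (0 < nth 0 kappa i)%N = (i < size kappa)%N.
Proof.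
case: kappa => s /= /andP[_ s0].
have [si|is_] := leqP (size s) i; first by rewrite nth_default.
by rewrite lt0n; apply: contraNneq s0 => <-; apply: mem_nth.
Qed.

Lemma eq_intpart (kappa la : intpart) N :
  (size kappa <= N)%N -> (size la <= N)%N ->
  (forall i, (i < N)%N -> nth 0%N kappa i = nth 0%N la i) -> kappa = la.
Proof.
move=> kN lN E.
have {}E i : nth 0%N kappa i = nth 0%N la i.
  have [/E//|Ni] := ltnP i N.
  by rewrite !nth_default // (leq_trans _ Ni).
have S i : (i < size kappa)%N = (i < size la)%N by rewrite -!intpart_nth_gt0 E.
apply/val_inj/(@eq_from_nth _ 0%N) => //=.
case: (ltngtP (size kappa) (size la)) => // H.
  by have := S (size kappa); rewrite H ltnn.
by have := S (size la); rewrite H ltnn.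
Qed.

Lemma shifted_part_anti N (kappa : intpart) (i j : 'I_N) :
  (i < j)%N -> (shifted_part kappa j < shifted_part kappa i)%N.
Proof.
move=> ij; rewrite /shifted_part -addnS leq_add ?intpart_nth_geq ?(ltnW ij) //.
by case: j ij => j /= jN ij; lia.
Qed.

Lemma shifted_part_inj N kappa : injective (@shifted_part N kappa).
Proof.
move=> i j E; apply/val_inj; case: (ltngtP i j) => // /(shifted_part_anti kappa);
by rewrite E ltnn.
Qed.

Lemma alternantE N kappa : alternant N kappa =
  \sum_(s : 'S_N) (-1) ^+ s *: 'X_[alt_mnm kappa s].
Proof.
apply: eq_bigr => s _; rewrite -mul_mpolyC rmorphXn rmorphN rmorph1.
congr (_ * _); rewrite mpolyXE_id; apply: eq_bigr => i _.
by rewrite mxE mnmE.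
Qed.

(** The exponents of $\kappa+\delta$ strictly decrease, so sorting a monomial recovers $\kappa$, and
    distinctness of the exponents recovers the permutation. *)
Lemma alt_mnm_eq N (kappa la : intpart) (s : 'S_N) :
  (size kappa <= N)%N -> (size la <= N)%N ->
  (alt_mnm kappa s == alt_mnm la 1) = (kappa == la) && (s == 1%g).
Proof.
move=> kN lN; apply/eqP/andP => [E|[/eqP-> /eqP->] //].
have {}E i : shifted_part kappa (s i) = shifted_part la i.
  by have /mnmP/(_ i) := E; rewrite !mnmE perm1.
have sorted_shift (rho : intpart) :
    sorted geq [seq shifted_part rho i | i <- enum 'I_N].
  rewrite sorted_map; apply: (@sub_sorted _ (fun i j : 'I_N => (i < j)%N)).
    by move=> i j /= /(shifted_part_anti rho)/ltnW.
  by have := iota_ltn_sorted 0 N; rewrite -val_enum_ord sorted_map.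
have Eseq : [seq shifted_part la i | i <- enum 'I_N]
          = [seq shifted_part kappa i | i <- enum 'I_N].
  apply: (@sorted_eq _ geq) => //.
  - by move=> y x z /= yx zy; apply: leq_trans zy yx.
  - by move=> x y /= /andP[xy yx]; apply/eqP; rewrite eqn_leq xy yx.
  have -> : [seq shifted_part la i | i <- enum 'I_N]
          = [seq shifted_part kappa i | i <- [seq s i | i <- enum 'I_N]].
    by rewrite -[RHS]map_comp; apply/eq_in_map => i _; rewrite /= E.
  apply: perm_map; apply: uniq_perm; rewrite ?(map_inj_uniq (@perm_inj _ s)) ?enum_uniq //.
  move=> i; rewrite mem_enum; apply/mapP; exists ((s^-1)%g i).
    by rewrite mem_enum.
  by rewrite permKV.
have E' (i : 'I_N) : shifted_part la i = shifted_part kappa i.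
  by have /eq_in_map/(_ i) := Eseq; apply; rewrite mem_enum.
split; apply/eqP; last first.
  by apply/permP => i; rewrite perm1; apply: (@shifted_part_inj N kappa); rewrite E.
apply: (@eq_intpart _ _ N) => // i iN.
by have := E' (Ordinal iN); rewrite /shifted_part /= => /addIn.
Qed.

Lemma mcoeff_alternant N (kappa la : intpart) :
  (size kappa <= N)%N -> (size la <= N)%N ->
  (alternant N kappa)@_(alt_mnm la 1) = (kappa == la)%:R.
Proof.
move=> kN lN; rewrite alternantE linear_sum (bigD1 (1%g : 'S_N)) //= big1 => [|s s1].
  by rewrite mcoeffZ mcoeffX alt_mnm_eq // eqxx odd_perm1 mul1r addr0 andbT.
by rewrite mcoeffZ mcoeffX alt_mnm_eq // (negbTE s1) andbF mulr0.
Qed.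

Lemma alternant_empty_neq0 N : alternant N empty_part != 0.
Proof.
apply/eqP => /(congr1 (mcoeff (alt_mnm empty_part 1))).
by rewrite mcoeff_alternant // eqxx mcoeff0.
Qed.

Lemma sumn_nth_ord (s : seq nat) N :
  (size s <= N)%N -> (\sum_(i < N) nth 0 s i)%N = sumn s.
Proof.
move=> sN; rewrite sumnE (big_nth 0%N) big_mkord.
rewrite (big_ord_widen N (fun i => nth 0%N s i) sN) [RHS]big_mkcond /=.
by apply: eq_bigr => i _; case: ltnP => // si; rewrite nth_default.
Qed.

Lemma mdeg_alt_mnm N (kappa : intpart) (s : 'S_N) :
  (size kappa <= N)%N -> mdeg (alt_mnm kappa s) = (sumn kappa + 'C(N, 2))%N.
Proof.
move=> kN; rewrite mdegE.
rewrite (eq_bigr (fun i => shifted_part kappa (s i))) => [|i _]; last by rewrite mnmE.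
have -> : (\sum_(i < N) shifted_part kappa (s i) = \sum_(i < N) shifted_part kappa i)%N.
  by rewrite [RHS](reindex_inj (@perm_inj _ s)).
rewrite big_split /= sumn_nth_ord //; congr addn.
 rewrite -bin2_sum big_mkord (reindex_inj rev_ord_inj) /=.
by apply: eq_bigr => i _; case: i => i /=; lia.
Qed.

(** * Bounding Littlewood--Richardson coefficients *)

Lemma schur_expansion_alternant N mu nu f : is_schur_expansion mu nu f ->
  exists F : {mpoly int[N]},
    (forall la : intpart, (size la <= N)%N -> F@_(alt_mnm la 1) = f la) /\
    alternant N empty_part * F
      = if (size mu <= N)%N && (size nu <= N)%N
        then alternant N mu * alternant N nu else 0.
Proof.
move=> /(_ N) E.
(* The expansion with the denominator cleared; partitions with more than [N] parts drop out, their
   Schur functions being 0 in [N] variables. *)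
pose F := \sum_(la <- finsupp f | (size la <= N)%N) alternant N la *~ f la.
exists F; split.
  move=> la lN; rewrite linear_sum /=.
  rewrite (eq_bigr (fun ka : intpart => (ka == la)%:R *~ f ka)); last first.
    by move=> ka kN; rewrite raddfMz /= mcoeff_alternant.
  have [laf|laf] := boolP (la \in finsupp f).
    rewrite big_mkcond (bigD1_seq la laf) ?fset_uniq //= lN eqxx big1 ?addr0 ?intz //.
    by move=> ka /negbTE->; rewrite mul0rz if_same.
  rewrite big_seq_cond big1 => [|ka /andP[kaf _]].
    by rewrite fsfun_dflt.
  by case: eqP => [E'|]; rewrite ?mul0rz //; rewrite E' (negbTE laf) in kaf.
have a0 : tofrac (alternant N empty_part) != 0.
  by rewrite tofrac_eq0 alternant_empty_neq0.
have FE : \sum_(la <- finsupp f) schur N la *~ f la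
    = tofrac F / tofrac (alternant N empty_part).
  rewrite rmorph_sum mulr_suml [RHS]big_mkcond /=; apply: eq_bigr => la _.
  rewrite /schur; case: ifP => _; last by rewrite mul0rz.
  by rewrite rmorphMz mulrzAl.
apply/eqP; rewrite -tofrac_eq tofracM; apply/eqP.
have -> : tofrac F = schur N mu * schur N nu * tofrac (alternant N empty_part).
  by rewrite E FE divfK.
rewrite /schur; case: (size mu <= N)%N => /=; last by rewrite !mul0r mulr0 tofrac0.
case: (size nu <= N)%N => /=; last by rewrite mulr0 mul0r mulr0 tofrac0.
rewrite tofracM; move: (tofrac _) (tofrac _) (tofrac _) a0 => y x z z0.
by rewrite mulrCA mulrACA !divfK.
Qed.

Lemma leq_expn2r m n k : (m <= n)%N -> (m ^ k <= n ^ k)%N.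
Proof. by move=> mn; case: k => // k; rewrite leq_exp2r. Qed.

(** The product of two alternants has $((p+1)!)^2$ signed monomials, and $x^{\lambda+\delta}$ has
    degree $|\lambda|+\binom{p+1}{2}$. Comparing degrees gives the size identity. *)
Lemma lr_coef_bound p (mu nu la : intpart) : (size la <= p.+1)%N ->
  `|lr_coef mu nu la|
    <= ((p.+1)`! ^ 2 * (sumn la + 2 * 'C(p.+1, 2)) ^ 'C(p, 2))%N%:Z /\
  (lr_coef mu nu la != 0 ->
   [/\ (size mu <= p.+1)%N, (size nu <= p.+1)%N & sumn la = (sumn mu + sumn nu)%N]).
Proof.
(* In the default branch of [xget] the coefficient is 0 and both claims are immediate. *)
move=> laN; rewrite /lr_coef; case: xgetP => [f _|_]; last first.
  by rewrite fsfun_dflt ?normr0 // finsupp0.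
move=> /(schur_expansion_alternant p.+1)[F [/(_ la laN) <-]].
case: ifP => [/andP[muN nuN]|_] FE; last first.
  have -> : F = 0.
    by apply/eqP; have /eqP := FE; rewrite mulf_eq0 (negbTE (alternant_empty_neq0 _)).
  by rewrite mcoeff0 normr0 eqxx.
pose a (s : 'S_p.+1 * 'S_p.+1) : int := (-1) ^+ s.1 * (-1) ^+ s.2.
have {}FE : alternant p.+1 empty_part * F
    = \sum_s a s *: 'X_[alt_mnm mu s.1 + alt_mnm nu s.2].
  rewrite FE !alternantE big_distrlr pair_big /=; apply: eq_bigr => s _.
  by rewrite mpolyXD -scalerAl -scalerAr scalerA.
have a1 s : `|a s| <= 1 by rewrite normrM !normrX normrN1 !expr1n.
have [le nz] := alternant_dvd_coef (alt_mnm la 1) FE a1; split.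
  apply: le_trans le _; rewrite lez_nat card_prod card_Sn mulnn leq_mul2l.
  apply/orP; right; rewrite mdeg_alt_mnm // leq_expn2r //.
  by rewrite mul2n -addnn addnA leq_add2l leq_bin2l.
move=> /nz[s]; rewrite mdegD !mdeg_alt_mnm // => E; split => //.
lia.
Qed.

(** * Counting triples and bounding Newell--Littlewood coefficients *)

(** Since the size is fixed, the first part is determined by the other [p], each at most [a]; this
    keeps the exponent at [p] instead of [p.+1]. *)
Lemma intparts_cover p a : exists2 r : seq intpart, size r = (a.+1 ^ p)%N &
  forall kappa : intpart, (size kappa <= p.+1)%N -> sumn kappa = a -> kappa \in r.
Proof.
pose P (f : {ffun 'I_p -> 'I_a.+1}) (kappa : intpart) :=
  [/\ (size kappa <= p.+1)%N, sumn kappa = a &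
      forall i : 'I_p, nth 0%N kappa i.+1 = f i].
have P_inj f kappa la : P f kappa -> P f la -> kappa = la.
  move=> [kN ka kf] [lN lea lf].
  apply: (@eq_intpart _ _ p.+1) => // -[_|i]; last first.
    by rewrite ltnS => ip; rewrite (kf (Ordinal ip)) (lf (Ordinal ip)).
  apply/eqP; rewrite -(eqn_add2r (\sum_(i < p) f i)%N).
  rewrite -[X in _ + X == _](eq_bigr _ (fun i _ => kf i)).
  rewrite -[X in _ == _ + X](eq_bigr _ (fun i _ => lf i)).
  rewrite -(big_ord_recl p (fun i => nth 0%N kappa i)).
  rewrite -(big_ord_recl p (fun i => nth 0%N la i)).
  by rewrite !sumn_nth_ord // ka lea.
exists [seq xget empty_part [set kappa | P f kappa]%classic
          | f <- enum {: {ffun 'I_p -> 'I_a.+1}}].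
  by rewrite size_map -cardE card_ffun !card_ord.
move=> kappa kN ka.
pose f : {ffun 'I_p -> 'I_a.+1} := [ffun i => inord (nth 0%N kappa (lift ord0 i))].
have Pf : P f kappa.
  split => // i; rewrite ffunE inordK // ltnS -ka -(sumn_nth_ord kN).
  by rewrite (bigD1 (lift ord0 i)) //= leq_addr.
apply/mapP; exists f; first by rewrite mem_enum.
by symmetry; apply: xget_unique => // la /= Pla; apply: P_inj Pla Pf.
Qed.

Lemma nl_coef_bound p T (mu nu la : intpart) :
    (size mu <= p.+1)%N -> (size nu <= p.+1)%N -> (size la <= p.+1)%N ->
    (sumn mu + sumn nu + sumn la + 2 * 'C(p.+1, 2) < T)%N ->
  `|nl_coef mu nu la| <= ((p.+1)`! ^ 6 * T ^ (3 * 'C(p.+1, 2)))%N%:Z.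
Proof.
move=> muN nuN laN T_gt; rewrite /nl_coef.
set F := (F in \sum_(p \in _) F p).
(* The only possible sizes of $\alpha,\beta,\gamma$, obtained by solving $|\alpha|+|\beta|=|\mu|$,
   $|\alpha|+|\gamma|=|\nu|$, $|\beta|+|\gamma|=|\lambda|$. *)
pose a := ((sumn mu + sumn nu) - sumn la)./2.
pose b := ((sumn mu + sumn la) - sumn nu)./2.
pose c := ((sumn nu + sumn la) - sumn mu)./2.
have [ra ra_size ra_mem] := intparts_cover p a.
have [rb rb_size rb_mem] := intparts_cover p b.
have [rc rc_size rc_mem] := intparts_cover p c.
pose r := undup [seq (x, z) | x <- [seq (x, y) | x <- ra, y <- rb], z <- rc].
have r_size : (size r <= T ^ (3 * p))%N.
  apply: leq_trans (size_undup _) _; rewrite !size_allpairs ra_size rb_size rc_size.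
  rewrite !mulSn mul0n addn0 addnA !expnD.
  by rewrite !leq_mul ?leq_expn2r // /a /b /c; lia.
pose B := ((p.+1)`! ^ 2 * T ^ 'C(p, 2))%N.
have F_le x : `|F x| <= (B ^ 3)%N%:Z.
  case: x => -[al be] ga; rewrite /F !normrM expnSr expnSr expn1 !PoszM.
  have le_B (x y z : intpart) : (size z <= p.+1)%N -> (sumn z + 2 * 'C(p.+1, 2) < T)%N ->
      `|lr_coef x y z| <= B%:Z.
    move=> zN zT; have [le _] := lr_coef_bound x y zN; apply: le_trans le _.
    by rewrite lez_nat leq_mul2l leq_expn2r ?orbT //; lia.
  by rewrite !ler_pM ?mulr_ge0 // le_B //; lia.
rewrite (@fsbigE _ _ _ _ _ r) ?undup_uniq //; last first.
  move=> [[al be] ga] _; apply: contraNeq; rewrite /F !mulf_eq0 !negb_or.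
  move=> /andP[/andP[nz1 nz2] nz3].
  have [_ /(_ nz1)[alN beN E1]] := lr_coef_bound al be muN.
  have [_ /(_ nz2)[_ gaN E2]] := lr_coef_bound al ga nuN.
  have [_ /(_ nz3)[_ _ E3]] := lr_coef_bound be ga laN.
  rewrite mem_undup; apply: allpairs_f; first apply: allpairs_f.
  - by apply: ra_mem => //; rewrite /a; lia.
  - by apply: rb_mem => //; rewrite /b; lia.
  - by apply: rc_mem => //; rewrite /c; lia.
apply: le_trans (ler_norm_sum _ _ _) _.
apply: (@le_trans _ _ (\sum_(x <- r) (B ^ 3)%N%:Z)).
  rewrite [leLHS]big_mkcond; apply: ler_sum => x _.
  by case: ifP => // _; apply: F_le.
rewrite big_const_seq count_predT iter_addr_0 -mulr_natr natz -PoszM lez_nat.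
rewrite mulnC; apply: leq_trans (leq_mul r_size (leqnn _)) _.
rewrite /B expnMn -!expnM binS bin1 mulnDr expnD.
by rewrite [('C(p, 2) * 3)%N]mulnC; lia.
Qed.

(** * Scaling, and degree from growth *)

Lemma sumn_scale_part t (kappa : intpart) :
  sumn (scale_part t kappa) = (t * sumn kappa)%N.
Proof.
rewrite /= /scale_parts; elim: (parts kappa) => [|x s IH] /=; first by rewrite muln0.
by case: posnP => [x0|_] /=; rewrite IH mulnDr // x0.
Qed.

Lemma size_scale_part t (kappa : intpart) :
  (size (scale_part t kappa) <= size kappa)%N.
Proof. by rewrite size_filter (leq_trans (count_size _ _)) // size_map. Qed.

(** The bound is asked only at arbitrarily large integers, so that it applies to one parity class at
    a time. *)
Lemma size_poly_growth (R : archiRealFieldType) (P : {poly R}) (C : R) (d : nat) :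
  (forall M, exists2 t : nat, (M < t)%N & `|P.[t%:R]| <= C * t%:R ^+ d) ->
  (size P <= d.+1)%N.
Proof.
move=> grow; rewrite leqNgt; apply/negP => dP.
have [D DE dD] : exists2 D, size P = D.+2 & (d <= D)%N.
  by exists (size P).-2; lia.
(* If the degree were [D.+1 > d], then at each $t\ge 1$ satisfying the bound the leading term would
   be at most $K t^D$, which fails for large $t$. *)
pose K := C + \sum_(i < D.+1) `|P`_i|.
have lead_gt0 : 0 < `|P`_D.+1|.
  by rewrite normr_gt0 -[D.+1]/(D.+2.-1) -DE -lead_coefE lead_coef_eq0 -size_poly_gt0 DE.
have [t Mt tP] := grow (Num.bound (K / `|P`_D.+1|)).
have t1 : 1 <= t%:R :> R by rewrite ler1n; case: t Mt {tP}.
have C0 : 0 <= C.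
  rewrite -(pmulr_lge0 _ (exprn_gt0 d (lt_le_trans ltr01 t1))).
  exact: le_trans tP.
suff : `|P`_D.+1| * t%:R <= K.
  rewrite mulrC -ler_pdivlMr // leNgt => /negP; apply.
  apply: lt_trans (_ : (Num.bound (K / `|P`_D.+1|))%:R < _); last by rewrite ltr_nat.
  by apply: archi_boundP; rewrite divr_ge0 // addr_ge0 // sumr_ge0.
rewrite -(ler_pM2r (exprn_gt0 D (lt_le_trans ltr01 t1))) -mulrA -exprS.
have -> : `|P`_D.+1| * t%:R ^+ D.+1
    = `|P.[t%:R] - \sum_(i < D.+1) P`_i * t%:R ^+ i|.
  rewrite horner_coef DE big_ord_recr /= addrAC subrr add0r normrM.
  by rewrite (ger0_norm (_ : 0 <= t%:R ^+ D.+1)) // exprn_ge0 // (le_trans ler01).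
apply: le_trans (ler_normB _ _) _; rewrite mulrDl; apply: lerD.
  by apply: le_trans tP _; rewrite ler_wpM2l // ler_weXn2l.
apply: le_trans (ler_norm_sum _ _ _) _; rewrite mulr_suml; apply: ler_sum => i _.
rewrite normrM ler_wpM2l // normrX ger0_norm ?(le_trans ler01) //.
by rewrite ler_weXn2l // -ltnS.
Qed.

Theorem mainTheorem7 (mu nu la : intpart) (Pe Po : {poly rat})
    (quasi_polynomial : forall t : nat, (1 <= t)%N ->
       (nl_coef (scale_part t mu) (scale_part t nu) (scale_part t la))%:~R
         = (if odd t then Po else Pe).[t%:R]) :
  let n := maxn (size mu) (maxn (size nu) (size la)) in
  let d := ((3 * n * (n - 1)) %/ 2)%N in
  (* size p is 1 + deg p, and 0 for p = 0 *)
  (size Pe <= d.+1)%N /\ (size Po <= d.+1)%N.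
Proof.
move=> n d; pose p := n.-1.
(* Here [p.+1] is $\max(n,1)$; for $n=0$ both sides vanish. *)
have dE : d = (3 * 'C(p.+1, 2))%N.
  have bin2M k : (2 * 'C(k.+1, 2) = k.+1 * k)%N.
    by elim: k => // k IH; rewrite binS bin1 mulnDr IH; lia.
  by rewrite /d /p; case: (n) => // k; have := bin2M k; rewrite /=; lia.
have [muN nuN laN] : [/\ size mu <= p.+1, size nu <= p.+1 & size la <= p.+1]%N.
  by rewrite /p /n; split; lia.
(* Chosen so that [A * t] strictly exceeds the scaled sizes plus [2 * 'C(p.+1, 2)] for every $t\ge
   1$. *)
pose A := (sumn mu + sumn nu + sumn la + (2 * 'C(p.+1, 2)).+1)%N.
have bound t : (0 < t)%N ->
    `|(if odd t then Po else Pe).[t%:R]| <= ((p.+1)`! ^ 6 * A ^ d)%N%:R * t%:R ^+ d.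
  move=> t0; rewrite -quasi_polynomial // -intr_norm.
  have := @nl_coef_bound p (A * t) (scale_part t mu) (scale_part t nu) (scale_part t la).
  rewrite !(leq_trans (size_scale_part _ _)) // => /(_ isT isT isT) le.
  rewrite -natrX -natrM [leRHS]pmulrn ler_int dE -mulnA -expnMn; apply: le.
  by rewrite !sumn_scale_part /A; nia.
split; apply: size_poly_growth => M.
  by exists M.*2.+2; [lia | have := bound M.*2.+2; rewrite /= negbK odd_double; apply].
by exists M.*2.+1; [lia | have := bound M.*2.+1; rewrite /= odd_double; apply].
Qed.
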